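(* Let $K$ be a field, $n\ge2$, $\Lambda=K\langle x_1,\dots,x_n\rangle$. Let $\lambda\in\Lambda$ be a comonic polynomial of positive degree and $\gamma\in\Lambda$ an arbitrary polynomial. Then $\lambda$ is a right factor of $\gamma$ (i.e. $\gamma\in\Lambda\lambda$) if and only if $b\star_\lambda\gamma=0$ for all monomials $b$ of degree $|\gamma|$; and in this case there is an algorithm to find the left quotient $\delta\in\Lambda$ satisfying $\gamma=\delta\lambda$. Symmetrically, $\lambda$ is a left factor of $\gamma$ (i.e. $\gamma\in\lambda\Lambda$) if and only if $\gamma\star_\lambda b=0$ for all monomials $b$ of degree $|\gamma|$; and in this case one can find successively (algorithmically) the right quotient $\delta\in\Lambda$ satisfying $\gamma=\lambda\delta$.
   Context: Every $\alpha\in\Lambda$ is written uniquely as $\alpha=k_\alpha+\sum_{i} x_i\alpha_{x_i}$ and as $\alpha=k_\alpha+\sum_i({}_{x_i}\alpha)x_i$ with $k_\alpha\in K$ and $\alpha_{x_i},{}_{x_i}\alpha\in\Lambda$ (right and left cofactors). $\alpha$ is comonic if $k_\alpha=1$; $|\alpha|$ is the total degree ($|0|=-\infty$). For comonic $\lambda$, the left action $\star_\lambda$ of $\Lambda$ on the vector space $\Lambda$ is the left module structure in which $x_i$ acts by $x_i\star_\lambda\alpha=-k_\alpha\lambda_{x_i}+\alpha_{x_i}$; thus $(x_{i_1}\cdots x_{i_m})\star_\lambda\alpha=x_{i_1}\star_\lambda(\cdots(x_{i_m}\star_\lambda\alpha))$. The right action is the right module structure in which $\alpha\star_\lambda x_i=-k_\alpha\,({}_{x_i}\lambda)+{}_{x_i}\alpha$;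 thus $\alpha\star_\lambda(x_{i_1}\cdots x_{i_m})=(\cdots(\alpha\star_\lambda x_{i_1})\cdots)\star_\lambda x_{i_m}$. ''Algorithm'' means a finite procedure using arithmetic operations and zero tests in $K$. *)

(* Defs.v *)
From HB Require Import structures.
From mathcomp Require Import all_boot all_order all_algebra.
From mathcomp Require Import finmap.
From mathcomp.multinomials Require Import monalg.

Set Implicit Arguments.
Unset Strict Implicit.
Unset Printing Implicit Defensive.

Import GRing.Theory.

Local Open Scope fset_scope.
Local Open Scope ring_scope.

Notation "1" := (@mone _) : monom_scope.
Notation "x * y" := (mmul x y) : monom_scope.

(* The free associative algebra K<x_1, ..., x_n> is the monoid algebra of the
   free monoid on 'I_n: the words are the basis, x_i is << fmu i >>, and the
   empty word is 1%M. *)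
Notation freealg K n := {malg K[{fmonom 'I_n}]}.

(* 1 + total degree, and 0 for the zero polynomial (as [size] for {poly R}), so
   that "b has degree |p|" is [(fdeg b).+1 = fsize p]: no word b satisfies it
   when p = 0, in accordance with |0| = -oo. *)
Notation fsize := (@mmeasure _ _ (@fdeg _)).

Section FreeAlgebra.
Variables (K : fieldType) (n : nat).
Implicit Types (p q a lam : freealg K n) (w : {fmonom 'I_n}) (i : 'I_n).

Definition comonic p : Prop := p@_1%M = 1.

(* The coefficient of w in rcof i p is that of x_i w in p, and in lcof i p it
   is that of w x_i; rcof_decomp, rcof_uniq and their left analogues below
   identify them with the cofactors. *)
Definition rcof i p : freealg K n :=
  [malg w in [fset FMonom (behead m) | m : {fmonom 'I_n} in msupp p]
     => p@_(fmu i * w)%M].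

Definition lcof i p : freealg K n :=
  [malg w in [fset FMonom (take (size m).-1 m) | m : {fmonom 'I_n} in msupp p]
     => p@_(w * fmu i)%M].

Definition lstep lam i a : freealg K n := - (a@_1%M *: rcof i lam) + rcof i a.
Definition rstep lam a i : freealg K n := - (a@_1%M *: lcof i lam) + lcof i a.

Definition lact lam p a : freealg K n :=
  \sum_(w <- msupp p) p@_w *: foldr (lstep lam) a w.

Definition ract lam a p : freealg K n :=
  \sum_(w <- msupp p) p@_w *: foldl (rstep lam) a w.

Lemma rcofE i p w : (rcof i p)@_w = p@_(fmu i * w)%M.
Proof.
rewrite mcoeffE; case: ifP => // /negbT wp; apply/esym/mcoeff_outdom.
apply: contra wp => xw; apply/imfsetP; exists (fmu i * w)%M => //=.
by rewrite fmM fmU /= fmK.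
Qed.

Lemma lcofE i p w : (lcof i p)@_w = p@_(w * fmu i)%M.
Proof.
rewrite mcoeffE; case: ifP => // /negbT wp; apply/esym/mcoeff_outdom.
apply: contra wp => xw; apply/imfsetP; exists (w * fmu i)%M => //=.
by rewrite fmM fmU /= size_cat addn1 take_size_cat // fmK.
Qed.

Let wordE w w' : w = w' :> seq 'I_n -> w = w'.
Proof. by move=> e; rewrite -[w]fmK -[w']fmK e. Qed.

Let mcoeff_xl i j p w :
  (<< fmu i >> * p)@_(fmu j * w)%M = p@_w *+ (i == j).
Proof.
rewrite (@mcoeffMlw _ _ [fset fmu i] (msupp p `|` [fset w])) ?msuppU_le //;
  last exact: fsubsetUl.
rewrite big_seq_fset1 (big_fsetD1 w) /=; last by rewrite !inE eqxx orbT.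
rewrite mcoeffUU mul1r big1_fset ?addr0.
  rewrite (_ : (_ == _) = (i == j)) //.
  by rewrite fmP !fmM !fmU /= eqseq_cons eqxx andbT.
move=> k; rewrite !inE => /andP[kw _] _.
by rewrite mul1r fmP !fmM !fmU /= eqseq_cons -fmP (negPf kw) andbF.
Qed.

Let mcoeff_xr i j p w :
  (p * << fmu i >>)@_(w * fmu j)%M = p@_w *+ (i == j).
Proof.
rewrite (@mcoeffMlw _ _ (msupp p `|` [fset w]) [fset fmu i]) ?msuppU_le //;
  last exact: fsubsetUl.
rewrite (big_fsetD1 w) /=; last by rewrite !inE eqxx orbT.
rewrite big_seq_fset1 mcoeffUU mulr1 big1_fset ?addr0.
  rewrite (_ : (_ == _) = (i == j)) //.
  by rewrite fmP !fmM !fmU /= !cats1 eqseq_rcons eqxx.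
move=> k; rewrite !inE => /andP[kw _] _.
by rewrite big_seq_fset1 mcoeffUU mulr1 fmP !fmM !fmU !cats1 eqseq_rcons -fmP
  (negPf kw).
Qed.

Let mcoeff_x1 i p q : (p * << fmu i >> * q)@_1%M = 0.
Proof. by rewrite !rmorphM /= mcoeffU fm1_eq1 mulr0n mulr0 mul0r. Qed.

Let wordl w : w = 1%M \/ exists i w', w = (fmu i * w')%M.
Proof.
case: w => -[|i s]; [left | right; exists i, (FMonom s)]; apply: wordE.
  by rewrite fm1.
by rewrite fmM fmU.
Qed.

Let wordr w : w = 1%M \/ exists i w', w = (w' * fmu i)%M.
Proof.
case: w => s; case/lastP: s => [|s i]; [left | right; exists i, (FMonom s)];
  apply: wordE; first by rewrite fm1.
by rewrite fmM fmU cats1.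
Qed.

Let coef_suml c (f : 'I_n -> freealg K n) :
  let s := c%:MP + \sum_i << fmu i >> * f i in
  s@_1%M = c /\ forall j w, s@_(fmu j * w)%M = (f j)@_w.
Proof.
split=> [|j w]; rewrite mcoeffD raddf_sum /= mcoeffC.
  rewrite eqxx mulr1n big1 ?addr0 // => i _.
  by rewrite -[<< _ >>]mul1r mcoeff_x1.
rewrite fmM_eq1 fm1_eq1 mulr0n add0r (bigD1 j) //=.
rewrite [X in X + _]mcoeff_xl eqxx.
by rewrite mulr1n big1 ?addr0 // => i ij; rewrite mcoeff_xl (negPf ij).
Qed.

Let coef_sumr c (f : 'I_n -> freealg K n) :
  let s := c%:MP + \sum_i f i * << fmu i >> in
  s@_1%M = c /\ forall j w, s@_(w * fmu j)%M = (f j)@_w.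
Proof.
split=> [|j w]; rewrite mcoeffD raddf_sum /= mcoeffC.
  rewrite eqxx mulr1n big1 ?addr0 // => i _.
  by rewrite -[_ * _]mulr1 mcoeff_x1.
rewrite fmM_eq1 fm1_eq1 andbF mulr0n add0r (bigD1 j) //=.
rewrite [X in X + _]mcoeff_xr eqxx.
by rewrite mulr1n big1 ?addr0 // => i ij; rewrite mcoeff_xr (negPf ij).
Qed.

Lemma rcof_decomp p : p = (p@_1%M)%:MP + \sum_i << fmu i >> * rcof i p.
Proof.
have [e1 ex] := coef_suml p@_1%M (rcof^~ p).
by apply/malgP => w; case: (wordl w) => [|[i [v]]] ->; rewrite ?e1 // ex rcofE.
Qed.

Lemma lcof_decomp p : p = (p@_1%M)%:MP + \sum_i lcof i p * << fmu i >>.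
Proof.
have [e1 ex] := coef_sumr p@_1%M (lcof^~ p).
by apply/malgP => w; case: (wordr w) => [|[i [v]]] ->; rewrite ?e1 // ex lcofE.
Qed.

Lemma rcof_uniq p (c : K) (f : 'I_n -> freealg K n) :
  p = c%:MP + \sum_i << fmu i >> * f i -> c = p@_1%M /\ f =1 rcof^~ p.
Proof.
move=> ->; have [e1 ex] := coef_suml c f.
by split=> [|i]; [rewrite e1 | apply/malgP => w; rewrite rcofE ex].
Qed.

Lemma lcof_uniq p (c : K) (f : 'I_n -> freealg K n) :
  p = c%:MP + \sum_i f i * << fmu i >> -> c = p@_1%M /\ f =1 lcof^~ p.
Proof.
move=> ->; have [e1 ex] := coef_sumr c f.
by split=> [|i]; [rewrite e1 | apply/malgP => w; rewrite lcofE ex].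
Qed.

Lemma lactU lam w a : lact lam << w >> a = foldr (lstep lam) a w.
Proof. by rewrite /lact msuppU1 big_seq_fset1 mcoeffUU scale1r. Qed.

Lemma ractU lam a w : ract lam a << w >> = foldl (rstep lam) a w.
Proof. by rewrite /ract msuppU1 big_seq_fset1 mcoeffUU scale1r. Qed.

Let lactEw lam a p (E : {fset {fmonom 'I_n}}) : msupp p `<=` E ->
  lact lam p a = \sum_(w <- E) p@_w *: foldr (lstep lam) a w.
Proof.
by move=> pE; apply: big_fset_incl => // w _ /mcoeff_outdom ->; rewrite scale0r.
Qed.

Let ractEw lam a p (E : {fset {fmonom 'I_n}}) : msupp p `<=` E ->
  ract lam a p = \sum_(w <- E) p@_w *: foldl (rstep lam) a w.
Proof.
by move=> pE; apply: big_fset_incl => // w _ /mcoeff_outdom ->; rewrite scale0r.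
Qed.

Lemma lactDl lam p q a : lact lam (p + q) a = lact lam p a + lact lam q a.
Proof.
rewrite (lactEw _ _ (msuppD_le p q)) (lactEw _ _ (fsubsetUl _ (msupp q))).
rewrite (lactEw _ _ (fsubsetUr (msupp p) _)) -big_split /=.
by apply: eq_bigr => w _; rewrite mcoeffD scalerDl.
Qed.

Lemma ractDr lam p q a : ract lam a (p + q) = ract lam a p + ract lam a q.
Proof.
rewrite (ractEw _ _ (msuppD_le p q)) (ractEw _ _ (fsubsetUl _ (msupp q))).
rewrite (ractEw _ _ (fsubsetUr (msupp p) _)) -big_split /=.
by apply: eq_bigr => w _; rewrite mcoeffD scalerDl.
Qed.

Lemma lactZl lam c p a : lact lam (c *: p) a = c *: lact lam p a.
Proof.
rewrite (lactEw _ _ (msuppZ_le c p)) scaler_sumr.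
by apply: eq_bigr => w _; rewrite mcoeffZ scalerA.
Qed.

Lemma ractZr lam c p a : ract lam a (c *: p) = c *: ract lam a p.
Proof.
rewrite (ractEw _ _ (msuppZ_le c p)) scaler_sumr.
by apply: eq_bigr => w _; rewrite mcoeffZ scalerA.
Qed.

Let lstepZ lam w c a b :
  foldr (lstep lam) (c *: a + b) w
    = c *: foldr (lstep lam) a w + foldr (lstep lam) b w.
Proof.
elim: (w : seq _) => //= i s ->; set x := foldr _ _ _; set y := foldr _ _ _.
apply/malgP => v; rewrite !(mcoeffD, mcoeffN, mcoeffZ, rcofE).
by rewrite !mulrDr !mulrDl !mulrN !opprD mulrA !addrA -!addrA; congr (_ + _);
  rewrite addrCA.
Qed.

Let rstepZ lam w c a b :
  foldl (rstep lam) (c *: a + b) w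
    = c *: foldl (rstep lam) a w + foldl (rstep lam) b w.
Proof.
elim: (w : seq _) a b => //= i s IHs a b; rewrite -IHs; congr foldl.
apply/malgP => v; rewrite !(mcoeffD, mcoeffN, mcoeffZ, lcofE).
by rewrite !mulrDr !mulrDl !mulrN !opprD mulrA !addrA -!addrA; congr (_ + _);
  rewrite addrCA.
Qed.

Lemma lact_linear lam p c a b :
  lact lam p (c *: a + b) = c *: lact lam p a + lact lam p b.
Proof.
rewrite /lact scaler_sumr -big_split; apply: eq_bigr => w _ /=.
by rewrite lstepZ scalerDr !scalerA mulrC.
Qed.

Lemma ract_linear lam p c a b :
  ract lam (c *: a + b) p = c *: ract lam a p + ract lam b p.
Proof.
rewrite /ract scaler_sumr -big_split; apply: eq_bigr => w _ /=.
by rewrite rstepZ scalerDr !scalerA mulrC.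
Qed.

Lemma lact1 lam a : lact lam 1 a = a.
Proof. by rewrite [1]/(<< 1%M >>) lactU fm1. Qed.

Lemma ract1 lam a : ract lam a 1 = a.
Proof. by rewrite [1]/(<< 1%M >>) ractU fm1. Qed.

Let act_sum (F : freealg K n -> freealg K n) :
  (forall p q, F (p + q) = F p + F q) ->
  forall (E : {fset {fmonom 'I_n}}) G,
    F (\sum_(w <- E) G w) = \sum_(w <- E) F (G w).
Proof.
move=> FD E G; apply: (big_morph F FD).
by apply: (addrI (F 0)); rewrite -FD !addr0.
Qed.

Let U_Z (c : K) w : << c *g w >> = c *: << w >> :> freealg K n.
Proof. by apply/malgP => v; rewrite mcoeffZ !mcoeffU mulrnAr mulr1. Qed.

Lemma lactM lam p q a : lact lam (p * q) a = lact lam p (lact lam q a).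
Proof.
have lD r : {morph lact lam r : x y / x + y}.
  by move=> x y; rewrite -[x]scale1r lact_linear !scale1r.
have lZ r c x : lact lam r (c *: x) = c *: lact lam r x.
  have l0 : lact lam r 0 = 0 by apply: (addrI (lact lam r 0)); rewrite -lD !addr0.
  by rewrite -[c *: x]addr0 lact_linear l0 addr0.
rewrite malgME (act_sum (fun x y => lactDl lam x y a)) {2}/lact.
apply: eq_bigr => u _; rewrite (act_sum (fun x y => lactDl lam x y a)).
rewrite -lactU (act_sum (lD _)) scaler_sumr; apply: eq_bigr => v _.
by rewrite U_Z lactZl lZ scalerA !lactU fmM foldr_cat.
Qed.

Lemma ractM lam p q a : ract lam a (p * q) = ract lam (ract lam a p) q.
Proof.
have rD r : {morph (ract lam)^~ r : x y / x + y}.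
  by move=> x y; rewrite -[x]scale1r ract_linear !scale1r.
have rZ r c x : ract lam (c *: x) r = c *: ract lam x r.
  have r0 : ract lam 0 r = 0.
    by apply: (addrI (ract lam 0 r)); rewrite -rD !addr0.
  by rewrite -[c *: x]addr0 ract_linear r0 addr0.
rewrite malgME (act_sum (fun x y => ractDr lam x y a)).
rewrite [ract lam a p]/ract (act_sum (rD q)); apply: eq_bigr => u _.
rewrite (act_sum (fun x y => ractDr lam x y a)) rZ [ract lam _ q]/ract.
rewrite scaler_sumr; apply: eq_bigr => v _.
by rewrite U_Z ractZr scalerA ractU fmM foldl_cat.
Qed.

End FreeAlgebra.

(* Algorithms: while programs over binary trees with leaves in K. The syntax
   does not mention K, so that a program can only reach the elements of K
   through the field operations, the constants 0 and 1, and zero tests. *)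

Inductive expr :=
  | EVar of nat
  | ENil | EPair of expr & expr | EFst of expr | ESnd of expr
  | EZero | EOne
  | EAdd of expr & expr | EOpp of expr | EMul of expr & expr | EInv of expr.

Inductive test := TPair of expr | TZero of expr.

Inductive prog :=
  | Skip
  | Assign of nat & expr
  | Seq of prog & prog
  | If of test & prog & prog
  | While of test & prog.

Inductive data (K : Type) := Nil | Leaf of K | Pair of data K & data K.
Arguments Nil {K}.

Section Semantics.
Variable K : fieldType.

Definition store := nat -> data K.

Definition update (s : store) (x : nat) (d : data K) : store :=
  fun y => if y == x then d else s y.

(* Ill-typed operations, such as an addition where an operand is not an element
   of K, or an inversion of 0, return Nil. *)
Fixpoint eval (s : store) (e : expr) : data K :=
  match e with
  | EVar x => s x
  | ENil => Nil
  | EPair e1 e2 => Pair (eval s e1) (eval s e2)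
  | EFst e => if eval s e is Pair d _ then d else Nil
  | ESnd e => if eval s e is Pair _ d then d else Nil
  | EZero => Leaf 0
  | EOne => Leaf 1
  | EAdd e1 e2 =>
      match eval s e1, eval s e2 with
      | Leaf a, Leaf b => Leaf (a + b)
      | _, _ => Nil
      end
  | EOpp e => if eval s e is Leaf a then Leaf (- a) else Nil
  | EMul e1 e2 =>
      match eval s e1, eval s e2 with
      | Leaf a, Leaf b => Leaf (a * b)
      | _, _ => Nil
      end
  | EInv e =>
      if eval s e is Leaf a then (if a == 0 then Nil else Leaf a^-1) else Nil
  end.

Definition holds (s : store) (t : test) : bool :=
  match t with
  | TPair e => if eval s e is Pair _ _ then true else false
  | TZero e => if eval s e is Leaf a then a == 0 else false
  end.

(* exec c s s' : run from the store s, the program c halts in the store s'. *)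
Inductive exec : prog -> store -> store -> Prop :=
  | ExecSkip s : exec Skip s s
  | ExecAssign s x e : exec (Assign x e) s (update s x (eval s e))
  | ExecSeq c1 c2 s1 s2 s3 :
      exec c1 s1 s2 -> exec c2 s2 s3 -> exec (Seq c1 c2) s1 s3
  | ExecIf t c1 c2 s s' :
      exec (if holds s t then c1 else c2) s s' -> exec (If t c1 c2) s s'
  | ExecWhileF t c s : ~~ holds s t -> exec (While t c) s s
  | ExecWhileT t c s1 s2 s3 :
      holds s1 t -> exec c s1 s2 -> exec (While t c) s2 s3 ->
      exec (While t c) s1 s3.

Lemma exec_det c s s1 s2 : exec c s s1 -> exec c s s2 -> s1 = s2.
Proof.
move=> ex; elim: ex s2 => {c s s1}.
- by move=> s s2 ex; inversion ex.
- by move=> s x e s2 ex; inversion ex.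
- move=> c1 c2 a b d _ IH1 _ IH2 s2 ex.
  inversion ex as [| |? ? ? b' ? ex1 ex2| | |]; subst.
  by apply: IH2; rewrite (IH1 _ ex1).
- by move=> t c1 c2 s s' _ IH s2 ex; inversion ex; subst; apply: IH.
- move=> t c s tF s2 ex.
  by inversion ex as [| | | |? ? ? _|? ? ? ? ? tT _ _]; subst; rewrite ?tT in tF.
- move=> t c a b d tT _ IH1 _ IH2 s2 ex.
  inversion ex as [| | | |? ? ? tF|? ? ? b' ? _ ex1 ex2]; subst.
    by rewrite tT in tF.
  by apply: IH2; rewrite (IH1 _ ex1).
Qed.

(* Finite words over 'I_n and finite lists of terms are encoded as lists, built
   from Nil and Pair as in Lisp; the letter x_i is a list of length i. *)
Definition enc_seq T (enc : T -> data K) (s : seq T) : data K :=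
  foldr (fun x d => Pair (enc x) d) Nil s.

Definition enc_nat (m : nat) : data K := iter m (Pair Nil) Nil.

Variable n : nat.

Definition enc_word (w : {fmonom 'I_n}) : data K :=
  enc_seq (fun i : 'I_n => enc_nat i) w.

(* A polynomial is given as a linear combination of words: a list of terms,
   in any order, where a word may be repeated and a coefficient may be 0. *)
Definition terms := seq ({fmonom 'I_n} * K).

Definition poly_of (ts : terms) : freealg K n :=
  \sum_(t <- ts) << t.2 *g t.1 >>.

Definition enc_terms (ts : terms) : data K :=
  enc_seq (fun t => Pair (enc_word t.1) (Leaf t.2)) ts.

(* From any presentations of lam (in variable 0) and gam (in variable 1), the
   program c halts with a presentation of some delta satisfying P in
   variable 0. *)
Definition finds (c : prog) (lam gam : freealg K n) (P : freealg K n -> Prop) :=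
  forall tlam tgam : terms, poly_of tlam = lam -> poly_of tgam = gam ->
  exists (tdelta : terms) (s : store),
    [/\ exec c (nth Nil [:: enc_terms tlam; enc_terms tgam]) s,
        s 0%N = enc_terms tdelta & P (poly_of tdelta)].

End Semantics.

(* Main.v *)
(* Let lam be comonic. For any a, a = k_a lam + sum_i x_i (x_i * a), where * is
   the action of lam: iterating this m times writes a as an element of
   Lambda lam plus the sum of the terms x_(i_1) ... x_(i_m) (b * a), with b the
   reversed word, so that a is in Lambda lam once all the words of length m kill
   it. Conversely, x_i * (d lam) = d_(x_i) lam, and taking the right cofactor
   |gam| times kills d because |d| < |gam|. Reversing words exchanges left and
   right.

   For the algorithm, the right quotient of gam = lam d is the power series
   gam - (lam - 1) gam + (lam - 1)^2 gam - ... truncated at any degree that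
   bounds |gam|. A term c w taken off a work list is output and replaced by the
   terms of -(lam - 1) c w, or dropped if w is too long. No zero test is needed,
   and this works for any presentation of lam and gam as linear combinations of
   words. *)

Require Import Defs.
From mathcomp Require Import all_boot all_order all_algebra.
From mathcomp Require Import finmap.
From mathcomp.multinomials Require Import monalg.

Set Implicit Arguments.
Unset Strict Implicit.
Unset Printing Implicit Defensive.

Import GRing.Theory.

Local Open Scope ring_scope.

(** * Cofactors and the left action *)

Section Convolution.
Variables (K : nzRingType) (I : choiceType).
Implicit Types (p q : {malg K[{fmonom I}]}) (s : seq I).

Lemma FMonomM s t : (FMonom s * FMonom t)%M = FMonom (s ++ t).
Proof. by rewrite -[LHS]fmK fmM. Qed.

Lemma eq_FMonom s t : (FMonom s == FMonom t) = (s == t).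
Proof. by rewrite fmP. Qed.

Lemma sum_msupp_eq p s (c : K) :
  \sum_(u <- msupp p) p@_u * c *+ (u == FMonom s) = p@_(FMonom s) * c.
Proof.
have [sp|sp] := boolP (FMonom s \in msupp p).
  rewrite (big_fsetD1 _ sp) /= eqxx big1_fset ?addr0 // => u.
  by rewrite !inE => /andP[/negPf -> _] _; rewrite mulr0n.
rewrite (mcoeff_outdom sp) mul0r big1_fset // => u up _.
by case: eqP => [eu|//]; rewrite eu (negPf sp) in up.
Qed.

Definition convol p q s : K :=
  \sum_(k < (size s).+1) p@_(FMonom (take k s)) * q@_(FMonom (drop k s)).

Lemma mcoeffM_FMonom p q s : (p * q)@_(FMonom s) = convol p q s.
Proof.
apply/esym; apply: etrans (esym (eq_bigr _ (fun (k : 'I_(size s).+1) _ =>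
  sum_msupp_eq p (take k s) (q@_(FMonom (drop k s)))))) _.
apply/esym.
rewrite mcoeffMl.
rewrite [RHS]exchange_big /=; apply: eq_bigr => -[u] _.
(* A word [u] of the left factor contributes only when it is a prefix of [s], and then only at the
   cut [size u]. *)
have [us|us] := boolP (prefix u s); last first.
  rewrite !big1 // => [k _|[v] _].
    case: eqP => // -[eu]; rewrite eu in us.
    by rewrite prefix_take in us.
  rewrite FMonomM eq_FMonom; case: eqP => // es.
  by rewrite -es prefix_prefix in us.
have /prefixP[v0 es] := us.
have lt_u : (size u < (size s).+1)%N by rewrite es size_cat ltnS leq_addr.
rewrite (bigD1 (Ordinal lt_u)) //= [X in _ = _ + X]big1 ?addr0.
  rewrite {2 3}es take_size_cat // drop_size_cat // eqxx mulr1n.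
  rewrite -[q@_ _]mulr1 -(sum_msupp_eq q v0) mulr_sumr.
  apply: eq_bigr => -[v] _.
  by rewrite mulr1 -mulrnAr FMonomM !eq_FMonom es eqseq_cat // eqxx.
move=> k; rewrite -val_eqE /= eq_FMonom => ku.
case: eqP => // eu; move: ku; rewrite {1}eu size_take_min.
by rewrite (minn_idPl _) ?eqxx // -ltnS.
Qed.
End Convolution.

(** * Degrees, cofactors of products and the right factor criterion *)

Section Division.
Variables (K : fieldType) (n : nat).
Implicit Types (p q a d lam gam : freealg K n) (s t : seq 'I_n).

Lemma fmuM (i : 'I_n) s : (fmu i * FMonom s)%M = FMonom (i :: s).
Proof. by rewrite -[LHS]fmK fmM fmU. Qed.

Lemma FMonom_nil : 1%M = FMonom [::] :> {fmonom 'I_n}.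
Proof. by rewrite -[LHS]fmK fm1. Qed.

Lemma freealgP p q : (forall s, p@_(FMonom s) = q@_(FMonom s)) -> p = q.
Proof. by move=> pq; apply/malgP => -[s]. Qed.

Lemma rcof_FMonom i p s : (rcof i p)@_(FMonom s) = p@_(FMonom (i :: s)).
Proof. by rewrite rcofE fmuM. Qed.

(** Either [p] supplies the empty word and the letter [i] comes from [q], or [i] is the first letter
    of a word of [p]. *)
Lemma mcoeffM_cons p q i s : (p * q)@_(FMonom (i :: s)) =
  p@_1%M * (rcof i q)@_(FMonom s) + (rcof i p * q)@_(FMonom s).
Proof.
rewrite !mcoeffM_FMonom /convol big_ord_recl /= rcof_FMonom FMonom_nil.
by congr (_ + _); apply: eq_bigr => k _; rewrite rcof_FMonom.
Qed.

Lemma mcoeffM_1 p q : (p * q)@_1%M = p@_1%M * q@_1%M.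
Proof. by rewrite FMonom_nil mcoeffM_FMonom /convol big_ord1. Qed.

Lemma rcof_exists (c : K) (f : 'I_n -> freealg K n) :
  exists2 d, d@_1%M = c & forall i, rcof i d = f i.
Proof.
pose d : freealg K n := c%:MP + \sum_i << fmu i >> * f i.
have [cE fE] := @rcof_uniq K n d c f erefl.
by exists d => // i; rewrite fE.
Qed.

Lemma mcoeff_fsize p s : (fsize p <= size s)%N -> p@_(FMonom s) = 0.
Proof.
move=> ps; apply/mcoeff_outdom.
exact: (@mmeasure_mnm_ge _ _ (@fdeg _) p (FMonom s)).
Qed.

Lemma fsize_le m p :
  (forall s, (m <= size s)%N -> p@_(FMonom s) = 0) -> (fsize p <= m)%N.
Proof.
move=> p0; rewrite mmeasureE; apply/bigmax_leqP_seq => -[s] sp _.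
rewrite ltnNge; apply: contraL sp => /p0/eqP.
by rewrite mcoeff_eq0.
Qed.

Lemma fsize_gt p s : p@_(FMonom s) != 0 -> (size s < fsize p)%N.
Proof. by apply: contraNT; rewrite -leqNgt => /mcoeff_fsize ->. Qed.

Lemma fsize_lead p :
  p != 0 -> exists2 s, (size s).+1 = fsize p & p@_(FMonom s) != 0.
Proof.
move=> p0; have [/hasP[[s]]|] :=
  boolP (has (fun w => (fdeg w).+1 == fsize p) (msupp p)).
  by rewrite -mcoeff_neq0 => ps /eqP sp; exists s.
move=> /hasPn/= noLead.
have sz : fsize p = (fsize p).-1.+1 := malgSpred (@fdeg _) p0.
suff: (fsize p <= (fsize p).-1)%N by rewrite {1}sz ltnn.
apply: fsize_le => s sp; apply/eqP; rewrite mcoeff_eq0; apply/negP => ps.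
have := noLead _ ps; have := mmeasure_mnm_lt (@fdeg _) ps.
rewrite fdegE/= => lt_s; rewrite eqn_leq lt_s /=.
by rewrite sz ltnS sp.
Qed.

(** In the concatenation of two leading words, any other cut leaves a prefix too long for [p] or a
    suffix too long for [q], so nothing cancels. The successor appears because [fsize] is the degree
    plus one. *)
Lemma fsizeM_ge p q :
  p != 0 -> q != 0 -> (fsize p + fsize q <= (fsize (p * q)%R).+1)%N.
Proof.
move=> p0 q0; have [s sp ps] := fsize_lead p0; have [t tq qt] := fsize_lead q0.
rewrite -sp -tq addSn addnS !ltnS -size_cat.
apply: fsize_gt; rewrite mcoeffM_FMonom /convol.
have lt_s : (size s < (size (s ++ t)).+1)%N by rewrite size_cat ltnS leq_addr.
rewrite (bigD1 (Ordinal lt_s)) //= take_size_cat // drop_size_cat //.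
rewrite big1 ?addr0 ?mulf_neq0 // => k; rewrite -val_eqE /= neq_ltn.
case/orP => [ks|sk].
  rewrite (mcoeff_fsize (p := q)) ?mulr0 // -tq size_drop.
  move: (nat_of_ord k) ks => j js.
  by rewrite ltn_subRL size_cat ltn_add2r.
rewrite mcoeff_fsize ?mul0r // size_take_min leq_min -sp sk.
by rewrite (leq_trans sk) // -ltnS.
Qed.

Lemma lstep_FMonom lam i a s : (lstep lam i a)@_(FMonom s) =
  a@_(FMonom (i :: s)) - a@_1%M * lam@_(FMonom (i :: s)).
Proof. by rewrite mcoeffD mcoeffN mcoeffZ !rcof_FMonom addrC. Qed.

(** As [lam] is comonic, [d * lam] has the constant term of [d], and the subtracted multiple of the
    cofactor of [lam] cancels the first summand of [mcoeffM_cons]. *)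
Lemma lstepM lam d i : comonic lam -> lstep lam i (d * lam) = rcof i d * lam.
Proof.
move=> lam1; apply: freealgP => s; rewrite lstep_FMonom mcoeffM_cons.
by rewrite mcoeffM_1 lam1 mulr1 rcof_FMonom addrAC subrr add0r.
Qed.

Lemma foldr_lstepM lam d s : comonic lam ->
  foldr (lstep lam) (d * lam) s = foldr (@rcof K n) d s * lam.
Proof.
move=> lam1; elim: s => [|i s IHs]; first by [].
exact: etrans (congr1 (lstep lam i) IHs)
  (lstepM (foldr (@rcof K n) d s) i lam1).
Qed.

(** [foldr] takes the cofactor for the last letter of [s] first, so the prefix removed from the
    words of [d] is [s] reversed. *)
Lemma foldr_rcofE d s t :
  (foldr (@rcof K n) d s)@_(FMonom t) = d@_(FMonom (rev s ++ t)).
Proof.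
by elim: s t => //= i s IHs t; rewrite rcof_FMonom IHs rev_cons cat_rcons.
Qed.

Lemma foldr_lstep0_factor lam m a : comonic lam ->
  (forall s, size s = m -> foldr (lstep lam) a s = 0) ->
  exists d, a = d * lam.
Proof.
move=> lam1; elim: m a => [|m IHm] a a0.
  by exists 0; rewrite mul0r; apply: (a0 [::]).
(* Words of length [m.+1] ending in [i] act on [a] as words of length [m] act on [lstep lam i a]. *)
have /fin_all_exists[f fE] i : exists d, lstep lam i a = d * lam.
  by apply: IHm => s sm; rewrite -foldr_rcons a0 // size_rcons sm.
(* The quotient has the constant term of [a] and, as right cofactors, the quotients [f i] given by
   induction. *)
have [d d1 dE] := rcof_exists a@_1%M f; exists d.
apply: freealgP => -[|i s]; first by rewrite -FMonom_nil mcoeffM_1 lam1 mulr1.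
by rewrite mcoeffM_cons dE -fE lstep_FMonom d1 rcof_FMonom addrC subrK.
Qed.

Lemma fsizeM_gt lam d : d != 0 -> (1 < fsize lam)%N ->
  (fsize d < fsize (d * lam)%R)%N.
Proof.
move=> d0 lam1.
have lam0 : lam != 0 by apply: contraTneq lam1 => ->; rewrite mmeasure0.
rewrite -ltnS; apply: leq_trans (fsizeM_ge d0 lam0).
by rewrite -addn2 leq_add2l.
Qed.

Lemma right_factorP lam gam : comonic lam -> (1 < fsize lam)%N ->
  (exists delta, gam = delta * lam) <->
  (forall b : {fmonom 'I_n}, (fdeg b).+1 = fsize gam ->
     lact lam << b >> gam = 0).
Proof.
move=> lam1 lam_pos; split=> [[d ->] b|gam0].
  (* For [d = 0] the product has [fsize] zero, and no word [b] satisfies the degree condition. *)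
  have [->|d0] := eqVneq d 0; first by rewrite mul0r mmeasure0.
  rewrite lactU foldr_lstepM // => bE.
  rewrite (_ : foldr _ _ _ = 0) ?mul0r //; apply: freealgP => s.
  rewrite mcoeff0 foldr_rcofE mcoeff_fsize // size_cat size_rev.
  rewrite -ltnS (leq_trans (fsizeM_gt d0 lam_pos)) // -bE fdegE.
  by rewrite ltnS leq_addr.
have [->|gam_neq0] := eqVneq gam 0; first by exists 0; rewrite mul0r.
apply: (foldr_lstep0_factor (m := (fsize gam).-1) lam1) => s sE.
have := gam0 (FMonom s); rewrite lactU; apply.
by rewrite fdegE /= sE -malgSpred.
Qed.

End Division.

(** * Reversal of words *)

Section Reversal.
Variables (K : fieldType) (n : nat).
Implicit Types (p q a d lam gam : freealg K n) (s t : seq 'I_n).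

(** The anti-automorphism of the free algebra that fixes the letters; it exchanges left and right
    factors. *)
Definition frev p : freealg K n :=
  [malg w in [fset FMonom (rev m) | m : {fmonom 'I_n} in msupp p]%fset
     => p@_(FMonom (rev w))].

Lemma frev_FMonom p s : (frev p)@_(FMonom s) = p@_(FMonom (rev s)).
Proof.
rewrite mcoeffE; case: ifP => // /negbT sp; apply/esym/mcoeff_outdom.
apply: contra sp => sp; apply/imfsetP; exists (FMonom (rev s)) => //=.
by rewrite revK.
Qed.

Lemma frevK : involutive frev.
Proof. by move=> p; apply: freealgP => s; rewrite !frev_FMonom revK. Qed.

Lemma frev0 : frev 0 = 0.
Proof. by apply: freealgP => s; rewrite frev_FMonom !mcoeff0. Qed.

Lemma frevM p q : frev (p * q) = frev q * frev p.
Proof.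
apply: freealgP => s; rewrite frev_FMonom !mcoeffM_FMonom /convol size_rev.
rewrite (reindex_inj rev_ord_inj); apply: eq_bigr => k _ /=.
by rewrite mulrC !frev_FMonom take_rev drop_rev subSS subKn // -ltnS.
Qed.

Lemma fsize_frev p : fsize (frev p) = fsize p.
Proof.
have le q : (fsize (frev q) <= fsize q)%N.
  by apply: fsize_le => s sq; rewrite frev_FMonom mcoeff_fsize ?size_rev.
by apply/eqP; rewrite eqn_leq le -{1}[p]frevK le.
Qed.

Lemma comonic_frev lam : comonic lam -> comonic (frev lam).
Proof. by rewrite /comonic FMonom_nil frev_FMonom. Qed.

Lemma lcof_FMonom i p s : (lcof i p)@_(FMonom s) = p@_(FMonom (rcons s i)).
Proof.
rewrite lcofE (_ : _ * _ = FMonom (rcons s i))%M // -cats1.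
by rewrite -[LHS]fmK fmM fmU.
Qed.

Lemma rstepE lam a i : rstep lam a i = frev (lstep (frev lam) i (frev a)).
Proof.
apply: freealgP => s; rewrite frev_FMonom lstep_FMonom FMonom_nil !frev_FMonom.
rewrite mcoeffD mcoeffN mcoeffZ !lcof_FMonom FMonom_nil addrC.
by rewrite rev_cons revK.
Qed.

(** Reversal conjugates the right action to the left one; the word is reversed too, since [foldl]
    acts by the first letter first and [foldr] by the last. *)
Lemma foldl_rstepE lam a s :
  foldl (rstep lam) a s = frev (foldr (lstep (frev lam)) (frev a) (rev s)).
Proof.
elim/last_ind: s => [|s i IHs]; first by rewrite frevK.
by rewrite foldl_rcons IHs rstepE frevK rev_rcons.
Qed.

Lemma left_factor_frev lam gam :
  (exists delta, gam = lam * delta) <->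
  (exists delta, frev gam = delta * frev lam).
Proof.
split=> -[d e]; exists (frev d).
  exact: etrans (congr1 frev e) (frevM lam d).
have := etrans (congr1 frev e) (frevM d (frev lam)).
by rewrite !frevK.
Qed.

Lemma left_factorP lam gam : comonic lam -> (1 < fsize lam)%N ->
  (exists delta, gam = lam * delta) <->
  (forall b : {fmonom 'I_n}, (fdeg b).+1 = fsize gam ->
     ract lam gam << b >> = 0).
Proof.
move=> lam1 lam_pos; rewrite left_factor_frev right_factorP; first last.
- by rewrite fsize_frev.
- exact: comonic_frev.
split=> gam0 b bE.
  have := gam0 (FMonom (rev b)); rewrite fsize_frev fdegE size_rev => /(_ bE).
  by rewrite lactU ractU foldl_rstepE => /= ->; apply: frev0.
rewrite lactU -[LHS]frevK -[X in foldr _ _ X]revK -foldl_rstepE.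
have := gam0 (FMonom (rev b)); rewrite ractU fdegE size_rev -fdegE => -> //.
  exact: frev0.
by rewrite bE fsize_frev.
Qed.

(** Left multiplication by [lam] is injective even on truncations: the cut at 0 contributes the
    coefficient at [s] itself, as [lam] is comonic, and the other cuts involve only shorter
    words. *)
Lemma comonic_convol_inj lam p q (m : nat) : comonic lam ->
  (forall s, (size s < m)%N -> convol lam p s = convol lam q s) ->
  forall s, (size s < m)%N -> p@_(FMonom s) = q@_(FMonom s).
Proof.
move=> lam1 pq s; have [k] := ubnP (size s); elim: k s => // k IHk s sk sm.
have := pq s sm; rewrite /convol !big_ord_recl /= take0 drop0.
rewrite -FMonom_nil lam1 !mul1r => e.
apply: (addIr (\sum_(j < size s) lam@_(FMonom (take j.+1 s)) *
  p@_(FMonom (drop j.+1 s)))); rewrite e; congr (_ + _).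
apply: eq_bigr => j _; congr (_ * _); apply/esym/IHk; rewrite size_drop.
  rewrite -ltnS (leq_trans _ sk) // ltnS ltn_subrL /=.
  exact: leq_ltn_trans (ltn_ord j).
exact: leq_ltn_trans (leq_subr _ _) sm.
Qed.

End Reversal.

(** * Division of presentations *)

Section Terms.
Variables (K : fieldType) (n : nat).
Implicit Types (p q r : freealg K n) (s : seq 'I_n) (c : K).
Implicit Types (w : {fmonom 'I_n}) (t : {fmonom 'I_n} * K).
Implicit Types (ts tl W : terms K n).

Lemma poly_of_nil : poly_of [::] = 0 :> freealg K n.
Proof. exact: big_nil. Qed.

Lemma mcoeff_poly_of ts s :
  (poly_of ts)@_(FMonom s) = \sum_(t <- ts) t.2 *+ (t.1 == s :> seq 'I_n).
Proof.
elim: ts => [|t ts IHts]; first by rewrite poly_of_nil mcoeff0 big_nil.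
by rewrite /poly_of big_cons mcoeffD IHts big_cons mcoeffU fmP.
Qed.

Lemma mcoeff_poly_of_cons t ts s :
  (poly_of (t :: ts))@_(FMonom s) =
  t.2 *+ (t.1 == s :> seq 'I_n) + (poly_of ts)@_(FMonom s).
Proof. by rewrite !mcoeff_poly_of big_cons. Qed.

Lemma convol_consl t ts r s :
  convol (poly_of (t :: ts)) r s
  = convol (poly_of [:: t]) r s + convol (poly_of ts) r s.
Proof.
rewrite /convol -big_split; apply: eq_bigr => k _.
by rewrite mcoeff_poly_of_cons (mcoeff_poly_of [:: t]) big_seq1 mulrDl.
Qed.

Lemma convol_consr t ts r s :
  convol r (poly_of (t :: ts)) s
  = convol r (poly_of [:: t]) s + convol r (poly_of ts) s.
Proof.
rewrite /convol -big_split; apply: eq_bigr => k _.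
by rewrite mcoeff_poly_of_cons (mcoeff_poly_of [:: t]) big_seq1 mulrDr.
Qed.

Lemma convol0 r s : convol r 0 s = 0.
Proof. by rewrite /convol big1 // => k _; rewrite mcoeff0 mulr0. Qed.

Lemma convol_terms1 t1 t2 s :
  convol (poly_of [:: t1]) (poly_of [:: t2]) s
  = t1.2 * t2.2 *+ (t1.1 ++ t2.1 == s).
Proof.
have e : poly_of [:: t1] * poly_of [:: t2]
  = << t1.2 * t2.2 *g (t1.1 * t2.1)%M >> :> freealg K n.
  by rewrite /poly_of 2!big_seq1; exact: fgmulUU.
by rewrite -mcoeffM_FMonom e mcoeffU fmP fmM.
Qed.

Lemma poly_of_rev ts : poly_of (rev ts) = poly_of ts.
Proof.
apply: freealgP => s; rewrite !mcoeff_poly_of; apply: perm_big.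
by rewrite perm_rev.
Qed.

Definition revt t : {fmonom 'I_n} * K := (FMonom (rev t.1), t.2).

Lemma poly_of_revt ts : poly_of (map revt ts) = frev (poly_of ts).
Proof.
apply: freealgP => s; rewrite frev_FMonom !mcoeff_poly_of big_map.
by apply: eq_bigr => t _; rewrite /= (can2_eq revK revK).
Qed.

(** Skipping the empty word leaves out the constant term of the divisor. The word of [t] is read
    reversed, which is what pushing its letters one by one on [w] yields. *)
Definition push w c W t : terms K n :=
  if nilp t.1 then W else (FMonom (rev t.1 ++ w), - (c * t.2)) :: W.

(** Pushing subtracts from [W] the product of the divisor, less its constant term, with [c w]; this
    product is moved to the other side here. *)
Lemma mcoeff_pushes tl w c W s :
  convol (poly_of (map revt tl)) (poly_of [:: (w, c)]) s
    + (poly_of (foldl (push w c) W tl))@_(FMonom s) =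
  (poly_of (map revt tl))@_1%M * c *+ (w == s :> seq 'I_n)
    + (poly_of W)@_(FMonom s).
Proof.
elim: tl W => [|t tl IHtl] W /=.
  rewrite poly_of_nil mcoeff0 /convol big1 => [|k _].
    by rewrite [0 * c]mul0r mul0rn.
  by rewrite mcoeff0 mul0r.
rewrite convol_consl convol_terms1 -addrA IHtl /push.
rewrite FMonom_nil mcoeff_poly_of_cons /nilp size_eq0 /=.
have [->|t1] := eqVneq (t.1 : seq 'I_n) [::].
  by rewrite /= mulr1n mulrDl mulrnDl addrA.
rewrite (_ : (rev _ == [::]) = false); last first.
  by rewrite -size_eq0 size_rev size_eq0 (negPf t1).
rewrite mulr0n add0r mcoeff_poly_of_cons /= addrCA; congr (_ + _).
by rewrite mulNrn mulrC addrA subrr add0r.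
Qed.

(** A termination measure: replacing a word shorter than [m] by at most [b - 1] longer ones lowers
    it. By truncated subtraction the words of length at least [m] weigh 1, so dropping one lowers it
    too. *)
Definition weight (b m : nat) ts := (\sum_(t <- ts) b ^ (m - size t.1))%N.

Lemma weight_pushes b m tl w c W : (0 < b)%N ->
  (weight b m (foldl (push w c) W tl)
     <= weight b m W + size tl * b ^ (m - (size w).+1))%N.
Proof.
move=> b_gt0; elim: tl W => [|t tl IHtl] W /=; first by rewrite mul0n addn0.
rewrite (leq_trans (IHtl _)) // mulSn addnA leq_add2r /push.
case: ifP => [_|/negbT t1]; first exact: leq_addr.
rewrite /weight big_cons addnC leq_add2l leq_pexp2l // size_cat size_rev.
by rewrite leq_sub2l // -[X in (X <= _)%N]add1n leq_add2r lt0n.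
Qed.

Lemma mcoeff_poly_of_long (m : nat) ts s :
  (forall t, t \in ts -> (size t.1 < m)%N) -> (m <= size s)%N ->
  (poly_of ts)@_(FMonom s) = 0.
Proof.
move=> lt_m ms; rewrite mcoeff_poly_of big1_seq // => t /andP[_ /lt_m tm].
by case: eqP => // ts1; move: tm; rewrite ts1 ltnNge ms.
Qed.

End Terms.

(** * Total correctness of while programs *)

Section Programs.
Variable K : fieldType.
Implicit Types (s : store K) (Q P : store K -> Prop) (a b : seq (data K)).

Definition wp c s Q := exists2 s', exec c s s' & Q s'.

Lemma wp_mono c s P Q : (forall s', P s' -> Q s') -> wp c s P -> wp c s Q.
Proof. by move=> PQ [s' ex /PQ Qs']; exists s'. Qed.

Lemma wp_skip s Q : Q s -> wp Skip s Q.
Proof. by exists s => //; apply: ExecSkip. Qed.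

Lemma wp_assign s x e Q : Q (update s x (eval s e)) -> wp (Assign x e) s Q.
Proof. by exists (update s x (eval s e)) => //; apply: ExecAssign. Qed.

Lemma wp_seq c1 c2 s Q :
  wp c1 s (fun s' => wp c2 s' Q) -> wp (Seq c1 c2) s Q.
Proof.
by move=> [s1 ex1 [s2 ex2 Qs2]]; exists s2 => //; apply: ExecSeq ex1 ex2.
Qed.

Lemma wp_if t c1 c2 s Q :
  wp (if holds s t then c1 else c2) s Q -> wp (If t c1 c2) s Q.
Proof. by move=> [s' ex Qs']; exists s' => //; apply: ExecIf. Qed.

(** The index of the invariant [I] is a variant: it must decrease strictly at each turn, which
    forces termination. *)
Lemma wp_while t c (I : nat -> store K -> Prop) k s :
  (forall m s1, I m s1 -> holds s1 t ->
     wp c s1 (fun s' => exists2 m', (m' < m)%N & I m' s')) ->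
  I k s ->
  wp (While t c) s (fun s' => (exists m, I m s') /\ ~~ holds s' t).
Proof.
move=> Ic; have [m] := ubnP k; elim: m k s => // m IHm k s km Ik.
have [ht|ht] := boolP (holds s t); last first.
  by exists s; [apply: ExecWhileF | split=> //; exists k].
have [s1 ex1 [k1 k1k Ik1]] := Ic _ _ Ik ht.
have [s2 ex2 Q2] := IHm k1 s1 (leq_trans k1k km) Ik1.
by exists s2 => //; apply: ExecWhileT ht ex1 ex2.
Qed.

(** For loops that consume the list in variable [x]: the remaining list is the variant, and the loop
    exits on [Nil], which is not a pair. *)
Lemma wp_while_seq T (enc : T -> data K) x c
    (I : seq T -> store K -> Prop) l s :
  (forall y l1 s1, s1 x = enc_seq enc (y :: l1) -> I (y :: l1) s1 ->
     wp c s1 (fun s' => s' x = enc_seq enc l1 /\ I l1 s')) ->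
  s x = enc_seq enc l -> I l s ->
  wp (While (TPair (EVar x)) c) s (I [::]).
Proof.
move=> Ic; elim: l s => [|y l IHl] s sx Is.
  by exists s => //; apply: ExecWhileF; rewrite /= sx.
have [s1 ex1 [s1x Is1]] := Ic _ _ _ sx Is.
have [s2 ex2 Is2] := IHl _ s1x Is1.
by exists s2 => //; apply: ExecWhileT ex1 ex2; rewrite /= sx.
Qed.

Lemma updateE s x d y : update s x d y = if y == x then d else s y.
Proof. by []. Qed.

Definition rev_append x u :=
  While (TPair (EVar x))
    (Seq (Assign u (EPair (EFst (EVar x)) (EVar u)))
         (Assign x (ESnd (EVar x)))).

Lemma wp_rev_append x u a b s Q :
  x != u -> s x = enc_seq id a -> s u = enc_seq id b ->
  (forall s', s' u = enc_seq id (catrev a b) ->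
     (forall y, y != x -> y != u -> s' y = s y) -> Q s') ->
  wp (rev_append x u) s Q.
Proof.
move=> xu sx su Qs.
pose I l s1 := exists b1, [/\ s1 u = enc_seq id b1, catrev l b1 = catrev a b
  & forall y, y != x -> y != u -> s1 y = s y].
apply: (@wp_mono _ _ (I [::])) => [s' [b1 [s'u /= eb fr]]|].
  by apply: Qs => //; rewrite -eb.
apply: wp_while_seq sx _ => [d l s1 s1x [b1 [s1u eb fr]]|]; last by exists b.
apply/wp_seq/wp_assign/wp_assign; rewrite /= !updateE eqxx (negPf xu) s1x.
split=> //; exists (d :: b1); split=> //.
  by rewrite !updateE eq_sym (negPf xu) eqxx s1u.
by move=> y yx yu; rewrite !updateE (negPf yx) (negPf yu) fr.
Qed.

(** Compares lengths by consuming both lists: [u] ends nonempty exactly when it was the longer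
    one. *)
Definition drop_prefix x u :=
  While (TPair (EVar x))
    (Seq (Assign u (ESnd (EVar u))) (Assign x (ESnd (EVar x)))).

Lemma wp_drop_prefix x u a b s Q :
  x != u -> s x = enc_seq id a -> s u = enc_seq id b ->
  (forall s', s' u = enc_seq id (drop (size a) b) ->
     (forall y, y != x -> y != u -> s' y = s y) -> Q s') ->
  wp (drop_prefix x u) s Q.
Proof.
move=> xu sx su Qs.
pose I (l : seq (data K)) s1 := exists b1, [/\ s1 u = enc_seq id b1,
  drop (size l) b1 = drop (size a) b
  & forall y, y != x -> y != u -> s1 y = s y].
apply: (@wp_mono _ _ (I [::])) => [s' [b1 [s'u /= eb fr]]|].
  by apply: Qs => //; rewrite -eb drop0.
apply: wp_while_seq sx _ => [d l s1 s1x [b1 [s1u eb fr]]|]; last by exists b.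
apply/wp_seq/wp_assign/wp_assign; rewrite /= !updateE eqxx (negPf xu) s1x.
split=> //; exists (behead b1); split=> //.
- by rewrite !updateE eq_sym (negPf xu) eqxx s1u; case: (b1).
- by rewrite -eb; case: (b1).
- by move=> y yx yu; rewrite !updateE (negPf yx) (negPf yu) fr.
Qed.

End Programs.

(** * The division program *)

(** The terms also come out in the opposite order, which leaves the polynomial they present
    unchanged. *)
Definition reverse_words src dst :=
  Seq (Assign dst ENil)
   (While (TPair (EVar src))
     (Seq (Assign 7 (EFst (EFst (EVar src))))
     (Seq (Assign 8 ENil)
     (Seq (rev_append 7 8)
     (Seq (Assign dst
             (EPair (EPair (EVar 8) (ESnd (EFst (EVar src)))) (EVar dst)))
          (Assign src (ESnd (EVar src)))))))).

(* [divide] divides the polynomial in variable 1 on the left by the reversal of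
   the one in variable 0: the words of the divisor are read reversed, so that a product
   v w is formed by pushing the letters of v on w. Variable 2 is a list longer
   than all the words of the dividend, 3 is the work list, 4 the output, 5 the
   current term, 6 runs through the divisor, 7 and 8 are scratch. *)
Definition length_bound :=
  Seq (Assign 2 (EPair ENil ENil))
  (Seq (Assign 3 (EVar 1))
   (While (TPair (EVar 3))
     (Seq (Assign 7 (EFst (EFst (EVar 3))))
     (Seq (rev_append 7 2)
          (Assign 3 (ESnd (EVar 3))))))).

Definition push_products :=
  Seq (Assign 6 (EVar 0))
   (While (TPair (EVar 6))
     (Seq (Assign 7 (EFst (EFst (EVar 6))))
     (Seq (If (TPair (EVar 7))
            (Seq (Assign 8 (EFst (EVar 5)))
            (Seq (rev_append 7 8)
                 (Assign 3 (EPair (EPair (EVar 8)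
                   (EOpp (EMul (ESnd (EVar 5)) (ESnd (EFst (EVar 6))))))
                   (EVar 3)))))
            Skip)
          (Assign 6 (ESnd (EVar 6)))))).

Definition divide :=
  Seq length_bound
  (Seq (Assign 3 (EVar 1))
  (Seq (Assign 4 ENil)
   (While (TPair (EVar 3))
     (Seq (Assign 5 (EFst (EVar 3)))
     (Seq (Assign 3 (ESnd (EVar 3)))
     (Seq (Assign 7 (EFst (EVar 5)))
     (Seq (Assign 8 (EVar 2))
     (Seq (drop_prefix 7 8)
          (If (TPair (EVar 8))
            (Seq (Assign 4 (EPair (EVar 5) (EVar 4))) push_products)
            Skip))))))))).

(** * Correctness of the subroutines *)

Section Correctness.
Variables (K : fieldType) (n : nat).
Implicit Types (s : store K) (t : {fmonom 'I_n} * K) (ts tl W : terms K n).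
Implicit Types (Q : store K -> Prop) (w : {fmonom 'I_n}).

Definition word_data w : seq (data K) :=
  map (fun i : 'I_n => enc_nat K i) w.

Lemma enc_wordE w : enc_word K w = enc_seq id (word_data w).
Proof. by rewrite /enc_word /word_data; elim: (w : seq _) => //= i l ->. Qed.

Lemma size_word_data w : size (word_data w) = size w.
Proof. exact: size_map. Qed.

Lemma enc_revcat w1 w2 :
  enc_seq id (catrev (word_data w1) (word_data w2))
  = enc_word K (FMonom (rev w1 ++ w2)).
Proof. by rewrite enc_wordE /word_data /= map_cat map_rev catrevE. Qed.

Lemma enc_rev w :
  enc_seq id (catrev (word_data w) [::]) = enc_word K (FMonom (rev w)).
Proof. by rewrite enc_wordE /word_data /= map_rev catrevE cats0. Qed.

Lemma wp_reverse_words src dst ts s Q :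
  src != dst -> (src != 7%N) && (src != 8%N) -> (dst != 7%N) && (dst != 8%N) ->
  s src = enc_terms ts ->
  (forall s', s' dst = enc_terms (rev (map (@revt K n) ts)) ->
     (forall y, y \notin [:: src; dst; 7; 8]%N -> s' y = s y) -> Q s') ->
  wp (reverse_words src dst) s Q.
Proof.
move=> sd /andP[s7 s8] /andP[d7 d8] sE Qs; apply/wp_seq/wp_assign => /=.
pose I l s1 := exists2 ts1, s1 dst = enc_terms ts1 &
  catrev (map (@revt K n) l) ts1 = rev (map (@revt K n) ts) /\
  forall y, y \notin [:: src; dst; 7; 8]%N -> s1 y = s y.
apply: (@wp_mono _ _ _ (I [::])) => [s' [ts1 s'd /= [eb fr]]|].
  by apply: Qs => //; rewrite s'd eb.
apply: (@wp_while_seq _ _ (fun t => Pair (enc_word K t.1) (Leaf t.2)) _ _ I ts);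
  last 1 first.
- exists [::]; first by rewrite updateE eqxx.
  split=> // y; rewrite !inE !negb_or => /and4P[ys yd y7 y8].
  by rewrite updateE (negPf yd).
- move=> t l s1 s1s [ts1 s1d [e fr]].
  apply/wp_seq/wp_assign/wp_seq/wp_assign/wp_seq.
  apply: (wp_rev_append (a := word_data t.1) (b := [::])) => //.
    by rewrite !updateE /= s1s /= enc_wordE.
  move=> s2 s2_8 fr2; apply/wp_seq/wp_assign/wp_assign => /=.
  have s2s : s2 src = s1 src by rewrite fr2 // !updateE (negPf s7) (negPf s8).
  have s2d : s2 dst = s1 dst by rewrite fr2 // !updateE (negPf d7) (negPf d8).
  rewrite !updateE eqxx (negPf sd) s2s s1s; split=> //.
  exists (revt t :: ts1).
    by rewrite !updateE eq_sym (negPf sd) eqxx s2_8 s2d s1d enc_rev.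
  split=> // y yn; have := yn; rewrite !inE !negb_or => /and4P[ys yd y7 y8].
  rewrite !updateE (negPf ys) (negPf yd) fr2 // !updateE (negPf y7) (negPf y8).
  exact: fr.
by rewrite updateE (negPf sd).
Qed.

(** Variable 2 starts with one entry and receives the letters of every word of the dividend, so its
    length is one plus the sum of their lengths and exceeds each. *)
Lemma wp_length_bound tg s Q :
  s 1%N = enc_terms tg ->
  (forall s' b, s' 2%N = enc_seq id b ->
     (forall t, t \in tg -> (size t.1 < size b)%N) ->
     s' 0%N = s 0%N -> s' 1%N = s 1%N -> Q s') ->
  wp length_bound s Q.
Proof.
move=> s1E Qs; apply/wp_seq/wp_assign/wp_seq/wp_assign => /=.
pose I (l : terms K n) s1 := exists2 b, s1 2%N = enc_seq id b &
  [/\ (0 < size b)%N,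
      (forall t, t \in tg -> (size t.1 < size b)%N \/ t \in l),
      s1 0%N = s 0%N & s1 1%N = s 1%N].
apply: (@wp_mono _ _ _ (I [::])) => [s' [b s'2 [_ lt_b e0 e1]]|].
  by apply: (Qs _ b) => // t /lt_b[].
apply: (@wp_while_seq _ _ (fun t => Pair (enc_word K t.1) (Leaf t.2)) _ _ I tg);
  last 1 first.
- by exists [:: enc_nat K 0] => //; split=> // t ?; right.
- move=> t l s2 s2_3 [b s2_2 [b_gt0 lt_b e0 e1]].
  apply/wp_seq/wp_assign/wp_seq.
  apply: (wp_rev_append (a := word_data t.1) (b := b)) => //.
    by rewrite !updateE /= s2_3 /= enc_wordE.
  move=> s3 s3_2 fr; apply/wp_assign => /=.
  rewrite updateE eqxx fr // updateE /= s2_3; split=> //.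
  exists (catrev (word_data t.1) b); first by rewrite updateE.
  rewrite !updateE /= !fr // !updateE /= catrevE size_cat size_rev.
  rewrite size_word_data; split=> //; first by rewrite addn_gt0 b_gt0 orbT.
  move=> u /lt_b[ub|]; first by left; rewrite ltn_addl.
  rewrite inE => /orP[/eqP->|]; last by right.
  by left; rewrite -[X in (X < _)%N]addn0 ltn_add2l.
by rewrite updateE.
Qed.

Lemma wp_push_products tl w (c : K) W s Q :
  s 0%N = enc_terms tl -> s 3%N = enc_terms W ->
  s 5%N = Pair (enc_word K w) (Leaf c) ->
  (forall s', s' 3%N = enc_terms (foldl (push w c) W tl) ->
     (forall y, (y < 3)%N || (y == 4%N) -> s' y = s y) -> Q s') ->
  wp push_products s Q.
Proof.
move=> s0 s3 s5 Qs; apply/wp_seq/wp_assign => /=.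
pose I (l : terms K n) s1 := exists2 W1, s1 3%N = enc_terms W1 &
  [/\ foldl (push w c) W1 l = foldl (push w c) W tl, s1 5%N = s 5%N &
      forall y, (y < 3)%N || (y == 4%N) -> s1 y = s y].
apply: (@wp_mono _ _ _ (I [::])) => [s' [W1 s'3 /= [eW _ fr]]|].
  by apply: Qs => //; rewrite s'3 eW.
apply: (@wp_while_seq _ _ (fun t => Pair (enc_word K t.1) (Leaf t.2)) _ _ I tl);
  last 1 first.
- exists W; first by rewrite updateE.
  by split=> // y; rewrite updateE; case: (y =P 6%N) => [->|].
- move=> t l s1 s1_6 [W1 s1_3 [eW e5 fr]].
  apply/wp_seq/wp_assign/wp_seq/wp_if.
  have h7 : holds (update s1 7%N (eval s1 (EFst (EFst (EVar 6)))))
    (TPair (EVar 7)) = ~~ nilp t.1.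
    rewrite /= updateE /= s1_6 /= enc_wordE /word_data.
    by case: (t.1 : seq _).
  rewrite h7; case: ifP => t1; last first.
    apply/wp_skip/wp_assign; rewrite /= !updateE /= s1_6; split=> //.
    exists W1; first by rewrite !updateE.
    split; first by rewrite -eW /= /push (negbFE t1).
      by rewrite !updateE.
    move=> y yP; rewrite !updateE -fr //.
    by case: (y =P 6%N) yP => [->|_] //; case: (y =P 7%N) => [->|_].
  apply/wp_seq/wp_assign/wp_seq.
  apply: (wp_rev_append (a := word_data t.1) (b := word_data w)) => //.
  - by rewrite !updateE /= s1_6 /= enc_wordE.
  - by rewrite !updateE /= !updateE /= e5 s5 /= enc_wordE.
  move=> s2 s2_8 fr2; apply/wp_assign/wp_assign => /=.
  have s2E y : y != 7%N -> y != 8%N -> s2 y = s1 y.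
    by move=> y7 y8; rewrite fr2 // !updateE (negPf y7) (negPf y8).
  rewrite !updateE /= s2E // s1_6; split=> //.
  exists (push w c W1 t).
    rewrite !updateE /= s2_8 !s2E // e5 s5 s1_3 /= /push (negPf t1).
    by rewrite enc_revcat.
  split; [exact: eW | by rewrite !updateE /= s2E |].
  move=> y yP; rewrite !updateE; move: (yP).
  case: (y =P 6%N) => [->|_] //; case: (y =P 3%N) => [->|_] //.
  move=> _; rewrite s2E ?fr //; by move: yP; apply: contraTneq => ->.
by rewrite updateE.
Qed.

End Correctness.

(** * Correctness of the division loop *)

Section DivideCorrectness.
Variables (K : fieldType) (n : nat).
Implicit Types (s : store K) (t : {fmonom 'I_n} * K) (ts tl tg : terms K n).
Implicit Types (Q : store K -> Prop) (d : freealg K n).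

Lemma wp_divide tl tg d s Q :
  comonic (poly_of (map (@revt K n) tl)) ->
  poly_of tg = poly_of (map (@revt K n) tl) * d ->
  s 0%N = enc_terms tl -> s 1%N = enc_terms tg ->
  (forall s' td, s' 4%N = enc_terms td -> poly_of td = d -> Q s') ->
  wp divide s Q.
Proof.
set lam := poly_of (map _ tl) => lam1 gam_d s0 s1 Qs.
apply: wp_seq; apply: (wp_length_bound s1) => s2 b s2_2 lt_b s2_0 s2_1.
apply/wp_seq/wp_assign/wp_seq/wp_assign => /=.
pose B := (size tl).+1.
(* Invariant: on words shorter than the bound, the divisor times the output, plus the work list,
   equals the dividend. The variant [k] is the weight of the work list. *)
pose I (k : nat) (s3 : store K) := [/\ s3 0%N = enc_terms tl,
  s3 2%N = enc_seq id b & exists tw td : terms K n,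
  [/\ s3 3%N = enc_terms tw, s3 4%N = enc_terms td, weight B (size b) tw = k,
    forall t, t \in td -> (size t.1 < size b)%N &
    forall u, (size u < size b)%N ->
      convol lam (poly_of td) u + (poly_of tw)@_(FMonom u)
        = (poly_of tg)@_(FMonom u)]].
have gam0 u : (size b <= size u)%N -> (poly_of tg)@_(FMonom u) = 0.
  by move=> bu; apply: (mcoeff_poly_of_long lt_b).
apply: (@wp_mono _ _ _
    (fun s' => (exists k, I k s') /\ ~~ holds s' (TPair (EVar 3)))).
  (* At exit the work list is empty. Below the bound the output agrees with [d] by injectivity; from
     the bound on both vanish, as the degree of [d] is at most that of the dividend. *)
  move=> s3 [[k [_ _ [tw [td [s3_3 s3_4 _ td_b e]]]]]] s3n.
  apply: (Qs _ _ s3_4); apply: freealgP => u.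
  have [ub|bu] := ltnP (size u) (size b).
    apply: (comonic_convol_inj lam1 _ ub) => v vb.
    have <- : (poly_of tg)@_(FMonom v) = convol lam d v.
      by rewrite gam_d; apply: mcoeffM_FMonom.
    rewrite -e //; case: tw s3_3 {e} => [|t tw] s3_3.
      by rewrite poly_of_nil mcoeff0 addr0.
    by rewrite /= s3_3 in s3n.
  rewrite (mcoeff_poly_of_long td_b bu) mcoeff_fsize //.
  apply: leq_trans bu; have [->|d0] := eqVneq d 0; first by rewrite mmeasure0.
  have lam0 : lam != 0.
    by apply: contra_eq_neq lam1 => ->; rewrite mcoeff0 eq_sym oner_eq0.
  apply: leq_trans (fsize_le gam0); rewrite gam_d -ltnS.
  apply: leq_trans (fsizeM_ge lam0 d0); rewrite -add1n leq_add2r lt0n.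
  by rewrite mmeasure_eq0.
apply: (wp_while (I := I) (k := weight B (size b) tg)); last first.
  split; rewrite ?updateE //=; first by rewrite s2_0.
  exists tg, [::]; rewrite ?updateE /= s2_1; split=> // u _.
  by rewrite poly_of_nil convol0 add0r.
move=> k s3 [s3_0 s3_2 [tw [td [s3_3 s3_4 wk td_b e]]]] /=.
rewrite s3_3; case: tw s3_3 wk e => //= -[w c] tw s3_3 wk e _.
apply/wp_seq/wp_assign/wp_seq/wp_assign/wp_seq/wp_assign/wp_seq/wp_assign.
apply: wp_seq.
apply: (wp_drop_prefix (a := word_data K w) (b := b)) => //.
- by rewrite /update /= s3_3 /= enc_wordE.
move=> s4 s4_8 fr; apply: wp_if.
have s4E y : y != 3%N -> y != 5%N -> y != 7%N -> y != 8%N -> s4 y = s3 y.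
  move=> y3 y5 y7 y8.
  by rewrite fr // /update /= (negPf y3) (negPf y5) (negPf y7) (negPf y8).
have s4_3 : s4 3%N = enc_terms tw by rewrite fr // /update /= s3_3.
have s4_5 : s4 5%N = Pair (enc_word K w) (Leaf c).
  by rewrite fr // /update /= s3_3.
rewrite size_word_data in s4_8.
have B_gt0 : (0 < B)%N by [].
have [wb|bw] := ltnP (size w) (size b); last first.
  rewrite /= s4_8 drop_oversize //; apply: wp_skip.
  exists (weight B (size b) tw).
    by rewrite -wk /weight big_cons -[X in (X < _)%N]add0n ltn_add2r expn_gt0.
  split; [by rewrite s4E | by rewrite s4E |].
  exists tw, td; rewrite s4_3 s4E //; split=> // u ub; rewrite -e //.
  congr (_ + _); rewrite mcoeff_poly_of_cons /= (_ : (_ == u) = false).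
    by rewrite mulr0n add0r.
  by apply: contraTF ub => /eqP <-; rewrite -leqNgt.
rewrite /= s4_8; case eb : (drop (size w) b) => [|x b1].
  have := size_drop (size w) b; rewrite eb => /esym/eqP.
  by rewrite subn_eq0 leqNgt wb.
rewrite /=; apply/wp_seq/wp_assign.
apply: (wp_push_products (tl := tl) (w := w) (c := c) (W := tw)).
- by rewrite updateE /= s4E.
- by rewrite updateE.
- by rewrite updateE.
move=> s5 s5_3 fr5; exists (weight B (size b) (foldl (push w c) tw tl)).
  (* The removed word weighs [B] times as much as a word one letter longer, and at most [size tl],
     which is less than [B], longer words are added. *)
  rewrite -wk /weight big_cons addnC.
  apply: leq_ltn_trans (weight_pushes _ _ _ _ _ B_gt0) _.
  rewrite ltn_add2l -(subnSK wb) expnS ltn_pmul2r //.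
  by rewrite expn_gt0.
split; [by rewrite fr5 // updateE /= s4E | by rewrite fr5 // updateE /= s4E |].
exists (foldl (push w c) tw tl), ((w, c) :: td).
rewrite s5_3 fr5 // updateE /= s4_5 s4E // s3_4; split=> //.
  by move=> t; rewrite inE => /predU1P[->|/td_b].
(* The divisor times the new output term [c w], added to the pushed terms, gives back the term [c w]
   taken off, because the constant term of the divisor is 1. *)
move=> u ub; rewrite -e // convol_consr addrAC mcoeff_pushes lam1 mul1r.
by rewrite mcoeff_poly_of_cons addrC.
Qed.

End DivideCorrectness.

Theorem theorem4p8 (K : fieldType) (n : nat) (hn : (2 <= n)%N) :
  exists left_quotient right_quotient : prog,
  forall lam gam : freealg K n, comonic lam -> (1 < fsize lam)%N ->
  [/\ (exists delta : freealg K n, gam = delta * lam) <->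
        (forall b : {fmonom 'I_n}, (fdeg b).+1 = fsize gam ->
           lact lam << b >> gam = 0),
      (exists delta : freealg K n, gam = delta * lam) ->
        finds left_quotient lam gam (fun delta => gam = delta * lam),
      (exists delta : freealg K n, gam = lam * delta) <->
        (forall b : {fmonom 'I_n}, (fdeg b).+1 = fsize gam ->
           ract lam gam << b >> = 0)
    & (exists delta : freealg K n, gam = lam * delta) ->
        finds right_quotient lam gam (fun delta => gam = lam * delta)].
Proof.
(* Reversal turns [gam = delta * lam] into a division on the left by the reversal of [lam]. As
   [divide] reverses the divisor itself, only the dividend and the result are reversed here. *)
exists (Seq (reverse_words 1 9) (Seq (Assign 1 (EVar 9))
  (Seq divide (reverse_words 4 0)))).
(* Reversing the divisor beforehand cancels the reversal made by [divide]. *)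
exists (Seq (reverse_words 0 9) (Seq (Assign 0 (EVar 9))
  (Seq divide (Assign 0 (EVar 4))))).
move=> lam gam lam1 lam_pos.
split; [exact: right_factorP | | exact: left_factorP |].
  move=> [d gam_d] tl tg tlE tgE.
  set c := Seq _ _; set s := nth _ _.
  suff [s' ex [td [s'0 tdE]]] : wp c s (fun s' => exists td : terms K n,
      s' 0%N = enc_terms td /\ poly_of td = d).
    exists td, s'; split; [exact: ex | exact: s'0 |].
    by rewrite tdE; exact: gam_d.
  apply: wp_seq; apply: (wp_reverse_words (ts := tg)) => // s1 s1_9 fr1.
  apply/wp_seq/wp_assign/wp_seq.
  have e1 : poly_of (map (@revt K n) tl) = frev lam by rewrite poly_of_revt tlE.
  have e2 : poly_of (rev (map (@revt K n) tg)) = frev lam * frev d.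
    rewrite poly_of_rev poly_of_revt tgE.
    exact: etrans (congr1 (@frev K n) gam_d) (frevM d lam).
  apply: (wp_divide (tl := tl) (d := frev d) (tg := rev (map (@revt K n) tg))).
  - by rewrite e1; apply: comonic_frev.
  - by rewrite e1.
  - by rewrite updateE /= fr1.
  - by rewrite updateE /=.
  move=> s2 td s2_4 tdE; apply: (wp_reverse_words (ts := td)) => // s3 s3_0 _.
  exists (rev (map (@revt K n) td)); split=> //.
  by rewrite poly_of_rev poly_of_revt tdE frevK.
move=> [d gam_d] tl tg tlE tgE.
set c := Seq _ _; set s := nth _ _.
suff [s' ex [td [s'0 tdE]]] : wp c s (fun s' => exists td : terms K n,
    s' 0%N = enc_terms td /\ poly_of td = d).
  exists td, s'; split; [exact: ex | exact: s'0 |].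
  by rewrite tdE; exact: gam_d.
apply: wp_seq; apply: (wp_reverse_words (ts := tl)) => // s1 s1_9 fr1.
apply/wp_seq/wp_assign/wp_seq.
pose tl' := rev (map (@revt K n) tl).
have e1 : poly_of (map (@revt K n) tl') = lam.
  by rewrite poly_of_revt poly_of_rev poly_of_revt tlE frevK.
apply: (wp_divide (tl := tl') (d := d) (tg := tg)).
- by rewrite e1.
- by rewrite e1 tgE.
- by rewrite updateE /=.
- by rewrite updateE /= fr1.
move=> s2 td s2_4 tdE; apply: wp_assign; exists td; split=> //.
Qed.
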